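(* For every $n\ge1$, $\mathcal N_{a,1}^{\otimes n}$ is imbedded into $E_{-p}^{\otimes n}$ by the map $i$; that is, the map $$i:\mathcal N_{a,1}^{\otimes n}\to E_{-p}^{\otimes n},\qquad f_n\mapsto\sum_{k_1,\dots,k_n=1}^\infty b_{k_1,\dots,k_n}\,e_{a,k_1}\otimes\cdots\otimes e_{a,k_n},\qquad b_{k_1,\dots,k_n}=\langle e_{a,k_1}\otimes\cdots\otimes e_{a,k_n},f_n\rangle_{c,2a-1},$$ with the series taken in $E_{-p}^{\otimes n}$, is a well-defined, continuous and injective linear map.
   Context: Let $\{e_k\}_{k\ge1}$ be an orthonormal basis of a complex Hilbert space $H$, and let $1<\lambda_1\le\lambda_2\le\cdots$ be reals with $\sum_k\lambda_k^{-2}<\infty$. For $r\in\mathbb R$ and $\xi=\sum_k\alpha_ke_k$ put $|\xi|_r^2=\sum_k\lambda_k^{2r}|\alpha_k|^2$. For $r\ge0$ let $E_r=\{\xi\in H:|\xi|_r<\infty\}$ and let $E_{-r}$ be the completion of $H$ for $|\cdot|_{-r}$. Let $E=\bigcap_{r\ge0}E_r$ (projective limit) with dual $E^*=\bigcup_{r\ge0}E_{-r}$ (inductive limit); $\langle\cdot,\cdot\rangle$ denotes the canonical bilinear pairing of $E^*$ with $E$. Tensor powers $E_{-p}^{\otimes n}$ are Hilbert space tensor powers. Fix $a\in(1/2,\infty)$ and a sequence $\{e_{a,k}\}_{k\ge1}\subset E^*$ such that: (C1) for all $k_1,k_2$, $\lim_{N\to\infty}\frac1{N^{2a-1}}\sum_{j=1}^N\overline{\langle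 e_{a,k_1},e_j\rangle}\langle e_{a,k_2},e_j\rangle$ equals $1$ if $k_1=k_2$ and $0$ otherwise; (C2) there are $p>0$ and $M>0$ with $|e_{a,k}|_{-p}\le M$ for all $k$ (such $p,M$ are fixed); (C3) for every $\alpha=\{\alpha_k\}\in\ell^1$ with $\alpha\ne0$, $\sum_k\alpha_ke_{a,k}\neq0$, the sum being taken in $E^*$. Let $H_{c,2a-1}$ be the Hilbert space with orthonormal basis $\{e_{a,k}\}_{k\ge1}$, with inner product $\langle\cdot,\cdot\rangle_{c,2a-1}$ conjugate-linear in the first variable (the same symbol is used on $H_{c,2a-1}^{\otimes n}$). Let $1<\lambda_{a,1}\le\lambda_{a,2}\le\cdots$ be reals with $\sum_k\lambda_{a,k}^{-2}<\infty$. For $r\ge0$ let $\mathcal N_{a,r}$ be the Hilbert space of all $\sum_k\alpha_ke_{a,k}\in H_{c,2a-1}$ with $\sum_k\lambda_{a,k}^{2r}|\alpha_k|^2<\infty$, with the corresponding norm; $\mathcal N_{a,r}^{\otimes n}$ is its Hilbert space tensor power. *)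

(* Defs.v *)
From HB Require Import structures.
From mathcomp Require Import all_boot all_order all_algebra.
From mathcomp Require Import all_classical all_reals all_analysis.
From mathcomp Require Import complex.
From mathcomp Require Import finmap ring lra.
From mathcomp Require Import summability.
Set Implicit Arguments.
Unset Strict Implicit.
Unset Printing Implicit Defensive.
Import Order.TTheory GRing.Theory Num.Theory numFieldNormedType.Exports.
Local Open Scope classical_set_scope.
Local Open Scope ring_scope.
Local Open Scope complex_scope.

Local Notation Re := complex.Re.
Local Notation Im := complex.Im.

HB.mixin Record CompleteNormedModule_hasInner (R : realType) V
    & CompleteNormedModule R[i] V := {
  inner : V -> V -> R[i] ;
  innerDr : forall x y z, inner x (y + z) = inner x y + inner x z ;
  innerZr : forall (c : R[i]) x y, inner x (c *: y) = c * inner x y ;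
  innerC : forall x y, inner y x = conjc (inner x y) ;
  innerxx : forall x, inner x x = `|x| ^+ 2
}.

#[short(type="hilbertType")]
HB.structure Definition Hilbert (R : realType) :=
  {V of CompleteNormedModule R[i] V & CompleteNormedModule_hasInner R V}.

Definition orthonormal_basis (R : realType) (V : hilbertType R)
    (e : nat -> V) : Prop :=
  (forall j k, inner (e j) (e k) = (j == k)%:R) /\
  (forall x, series (fun k => inner (e k) x *: e k) @ \oo --> x).

Record weight_seq (R : realType) := WeightSeq {
  wt :> nat -> R ;
  wt_gt1 : forall k, 1 < wt k ;
  wt_mono : forall j k, (j <= k)%N -> wt j <= wt k ;
  wt_summable : cvgn (series (fun k => wt k ^- 2))
}.

(* Componentwise limit of the partial sums; the sum of the series whenever it
   converges, in particular when it converges absolutely. *)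
Definition csum (R : realType) (t : nat -> R[i]) : R[i] :=
  limn (series (fun k => Re (t k))) +i* limn (series (fun k => Im (t k))).

Section seqs.
Context {R : realType}.
Implicit Types (t x y z : nat -> R[i]) (c : R[i]).

Definition abs_summable t := cvgn (series (fun k => Normc.normc (t k))).

Lemma normc_sq c : Normc.normc c ^+ 2 = Re c ^+ 2 + Im c ^+ 2.
Proof. by case: c => a b /=; rewrite sqr_sqrtr // addr_ge0 ?sqr_ge0. Qed.

Lemma normc_ge0 c : 0 <= Normc.normc c.
Proof. by case: c => a b /=; rewrite sqrtr_ge0. Qed.

Lemma normcJ' c : Normc.normc (conjc c) = Normc.normc c.
Proof. by case: c => a b /=; rewrite sqrrN. Qed.

Lemma normc_realC (a : R) : 0 <= a -> Normc.normc a%:C = a.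
Proof. by move=> a0 /=; rewrite expr0n /= addr0 sqrtr_sqr ger0_norm. Qed.

Lemma normcE' c : `|c| = (Normc.normc c)%:C.
Proof. by rewrite normc_def; case: c. Qed.

Lemma absRe_le c : `|Re c| <= Normc.normc c.
Proof.
by rewrite -(ler_pXn2r (n := 2)) ?nnegrE ?normc_ge0 // normc_sq real_normK
  ?num_real // lerDl sqr_ge0.
Qed.

Lemma absIm_le c : `|Im c| <= Normc.normc c.
Proof.
by rewrite -(ler_pXn2r (n := 2)) ?nnegrE ?normc_ge0 // normc_sq real_normK
  ?num_real // lerDr sqr_ge0.
Qed.

Lemma abs_summable_cvg t (f : R[i] -> R) :
  (forall c, `|f c| <= Normc.normc c) ->
  abs_summable t -> cvgn (series (fun k => f (t k))).
Proof.
move=> fle tc; apply: normed_cvg.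
by apply: series_le_cvg tc => // n; rewrite ?normr_ge0 ?normc_ge0 ?fle.
Qed.

Lemma abs_cvgRe t : abs_summable t -> cvgn (series (fun k => Re (t k))).
Proof. exact: (abs_summable_cvg absRe_le). Qed.
Lemma abs_cvgIm t : abs_summable t -> cvgn (series (fun k => Im (t k))).
Proof. exact: (abs_summable_cvg absIm_le). Qed.

Lemma csumD t1 t2 : abs_summable t1 -> abs_summable t2 ->
  csum (fun k => t1 k + t2 k) = csum t1 + csum t2.
Proof.
move=> h1 h2; rewrite /csum.
under eq_fun do rewrite raddfD /=.
under [X in _ +i* limn (series X)]eq_fun do rewrite raddfD /=.
rewrite -[X in X +i* _]/(limn (series ((fun k => Re (t1 k)) + (fun k => Re (t2 k))))).
rewrite -[X in _ +i* X]/(limn (series ((fun k => Im (t1 k)) + (fun k => Im (t2 k))))).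
have [r1 r2] := (abs_cvgRe h1, abs_cvgRe h2).
have [i1 i2] := (abs_cvgIm h1, abs_cvgIm h2).
by rewrite (lim_seriesD r1 r2) (lim_seriesD i1 i2).
Qed.

Lemma csumZ c t : abs_summable t -> csum (fun k => c * t k) = c * csum t.
Proof.
case: c => a b h; rewrite /csum.
have hR := abs_cvgRe h; have hI := abs_cvgIm h.
have -> : (fun k => Re ((a +i* b) * t k)) =
    a *: (fun k => Re (t k)) - b *: (fun k => Im (t k)).
  by apply/funext => k; rewrite !fctE /=; case: (t k).
have -> : (fun k => Im ((a +i* b) * t k)) =
    a *: (fun k => Im (t k)) + b *: (fun k => Re (t k)).
  by apply/funext => k; rewrite !fctE /=; case: (t k).
rewrite (lim_seriesB (is_cvg_seriesZ hR) (is_cvg_seriesZ hI)).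
rewrite (lim_seriesD (is_cvg_seriesZ hI) (is_cvg_seriesZ hR)).
rewrite (lim_seriesZ _ hR) (lim_seriesZ _ hI) (lim_seriesZ _ hR) (lim_seriesZ _ hI).
by [].
Qed.

Lemma csumJ t : abs_summable t -> csum (fun k => conjc (t k)) = conjc (csum t).
Proof.
move=> h; rewrite /csum.
have -> : (fun k => Re (conjc (t k))) = (fun k => Re (t k)).
  by apply/funext => k; case: (t k).
have -> : (fun k => Im (conjc (t k))) = - (fun k => Im (t k)).
  by apply/funext => k; rewrite fctE; case: (t k).
by rewrite lim_seriesN //; exact: abs_cvgIm.
Qed.

Section wl2.
Variable w : nat -> R.
Hypothesis w_gt0 : forall k, 0 < w k.

Definition wterm x k := w k * Normc.normc (x k) ^+ 2.
Definition wsummable x := cvgn (series (wterm x)).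
Definition wform x y := csum (fun k => (w k)%:C * conjc (x k) * y k).

Lemma wterm_ge0 x k : 0 <= wterm x k.
Proof. by rewrite mulr_ge0 ?sqr_ge0 ?(ltW (w_gt0 k)). Qed.

Lemma wsummable_bounded x (B : R) :
  (forall n, series (wterm x) n <= B) -> wsummable x.
Proof.
move=> h; apply: nondecreasing_is_cvgn.
  by apply: nondecreasing_series => k _ _; exact: wterm_ge0.
by exists B => _ [n _ <-].
Qed.

Lemma wsummable_le x n : wsummable x ->
  series (wterm x) n <= limn (series (wterm x)).
Proof.
move=> h; apply: nondecreasing_cvgn_le => //.
by apply: nondecreasing_series => k _ _; exact: wterm_ge0.
Qed.

Lemma wsummable0 : wsummable (fun=> 0).
Proof.
apply: (@wsummable_bounded _ 0) => n; rewrite /series /=.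
by rewrite big1 // => k _; rewrite /wterm /= expr0n /= addr0 sqrtr0 expr0n mulr0.
Qed.

Lemma wtermZ c x k : wterm (fun k => c * x k) k = Normc.normc c ^+ 2 * wterm x k.
Proof. by rewrite /wterm Normc.normcM exprMn mulrCA. Qed.

Lemma wtermD x y k : wterm (fun k => x k + y k) k <= 2 * wterm x k + 2 * wterm y k.
Proof.
rewrite /wterm !normc_sq.
case: (x k) (y k) => [a b] [c d] /=.
rewrite (mulrCA 2) (mulrCA 2) -mulrDr ler_wpM2l ?(ltW (w_gt0 _)) //.
have := sqr_ge0 (a - c); have := sqr_ge0 (b - d); lra.
Qed.

Lemma wsummableZ c x : wsummable x -> wsummable (fun k => c * x k).
Proof.
move=> h; rewrite /wsummable (_ : wterm _ = Normc.normc c ^+ 2 *: wterm x).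
  exact: is_cvg_seriesZ.
by apply/funext => k; rewrite wtermZ.
Qed.

Lemma wsummableD x y : wsummable x -> wsummable y ->
  wsummable (fun k => x k + y k).
Proof.
move=> hx hy.
apply: (@series_le_cvg _ _ (2 *: wterm x + 2 *: wterm y)).
- exact: wterm_ge0.
- by move=> n; rewrite addr_ge0 // mulr_ge0 // wterm_ge0.
- exact: wtermD.
- by apply: is_cvg_seriesD; exact: is_cvg_seriesZ.
Qed.

Lemma wform_abs x y : wsummable x -> wsummable y ->
  abs_summable (fun k => (w k)%:C * conjc (x k) * y k).
Proof.
move=> hx hy; apply: (@series_le_cvg _ _ (wterm x + wterm y)).
- by move=> n; exact: normc_ge0.
- by move=> n; rewrite addr_ge0 // wterm_ge0.
- move=> n; rewrite !Normc.normcM normcJ' normc_realC ?(ltW (w_gt0 _)) //.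
  apply: (@le_trans _ _ (wterm x n + wterm y n)) => //.
  rewrite /wterm -mulrA -mulrDr ler_wpM2l ?(ltW (w_gt0 _)) //.
  have := normc_ge0 (x n); have := normc_ge0 (y n).
  move: (Normc.normc _) (Normc.normc _) => u v u0 v0.
  by have := sqr_ge0 (v - u); have := mulr_ge0 u0 v0; nra.
- exact: is_cvg_seriesD.
Qed.

Lemma wformDr x y z : wsummable x -> wsummable y -> wsummable z ->
  wform x (fun k => y k + z k) = wform x y + wform x z.
Proof.
move=> hx hy hz; rewrite /wform -csumD; try exact: wform_abs.
by congr csum; apply/funext => k; rewrite mulrDr.
Qed.

Lemma wformZr c x y : wsummable x -> wsummable y ->
  wform x (fun k => c * y k) = c * wform x y.
Proof.
move=> hx hy; rewrite /wform -csumZ; last exact: wform_abs.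
by congr csum; apply/funext => k; rewrite mulrCA.
Qed.

Lemma wformC x y : wsummable x -> wsummable y ->
  wform y x = conjc (wform x y).
Proof.
move=> hx hy; rewrite /wform -csumJ; last exact: wform_abs.
congr csum; apply/funext => k.
by rewrite !rmorphM /= conjcK oppr0 mulrAC.
Qed.

Lemma wformxx x : wform x x = (limn (series (wterm x)))%:C.
Proof.
rewrite /wform /csum.
have -> : (fun k => Re ((w k)%:C * conjc (x k) * x k)) = wterm x.
  apply/funext => k; rewrite /wterm normc_sq; case: (x k) => a b /=; ring.
have -> : (fun k => Im ((w k)%:C * conjc (x k) * x k)) = (fun=> 0).
  apply/funext => k; case: (x k) => a b /=; ring.
congr (_ +i* _); rewrite (_ : series _ = (fun=> 0)) ?lim_cst //.
by apply/funext => n; rewrite /series /= big1.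
Qed.

Definition wnorm x : R := Num.sqrt (limn (series (wterm x))).

Lemma wlim_ge0 x : wsummable x -> 0 <= limn (series (wterm x)).
Proof.
by move=> h; apply: le_trans (wsummable_le 0 h); rewrite /series /= big_geq.
Qed.

Lemma wnorm_sq x : wsummable x -> wnorm x ^+ 2 = limn (series (wterm x)).
Proof. by move=> h; rewrite sqr_sqrtr // wlim_ge0. Qed.

Lemma wnormZ c x : wsummable x ->
  wnorm (fun k => c * x k) = Normc.normc c * wnorm x.
Proof.
move=> h; rewrite /wnorm (_ : wterm _ = Normc.normc c ^+ 2 *: wterm x).
  by rewrite lim_seriesZ // sqrtrM ?sqr_ge0 // sqrtr_sqr ger0_norm // normc_ge0.
by apply/funext => k; rewrite wtermZ.
Qed.

Lemma wnorm_eq0 x : wsummable x -> wnorm x = 0 -> x = fun=> 0.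
Proof.
move=> h /eqP; rewrite sqrtr_eq0 => h0.
apply/funext => k.
have hs : series (wterm x) k.+1 <= 0 by apply: le_trans (wsummable_le _ h) h0.
have : wterm x k <= 0.
  apply: le_trans hs; rewrite /series /= big_nat_recr //= lerDr sumr_ge0 //.
  by move=> i _; exact: wterm_ge0.
rewrite /wterm pmulr_rle0 // => hk.
have : Normc.normc (x k) ^+ 2 == 0 by rewrite eq_le hk sqr_ge0.
by rewrite expf_eq0 /= => /eqP /Normc.eq0_normc.
Qed.

Lemma wform_shift (s : R) x y : wsummable x -> wsummable y ->
  limn (series (wterm (fun k => x k + s%:C * y k))) =
  limn (series (wterm x)) + 2 * s * Re (wform x y)
  + s ^+ 2 * limn (series (wterm y)).
Proof.
move=> hx hy.
have hsy : wsummable (fun k => s%:C * y k) by exact: wsummableZ.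
apply: (@complexI R); rewrite -wformxx.
rewrite wformDr ?wformZr //; try exact: wsummableD.
rewrite (wformC (x := x)) // ?(wformC (x := y) (y := fun k => _ + _)) //;
  try exact: wsummableD.
rewrite !wformDr // !wformZr // !wformxx (wformC (x := x) (y := y)) //.
case: (wform x y) => a b /=.
by apply/eqP; rewrite eq_complex /=; apply/andP; split; apply/eqP; ring.
Qed.

Lemma wformCS x y : wsummable x -> wsummable y ->
  Re (wform x y) <= wnorm x * wnorm y.
Proof.
move=> hx hy.
have key (s : R) : 0 <= wnorm x ^+ 2 + 2 * s * Re (wform x y) + s ^+ 2 * wnorm y ^+ 2.
  rewrite !wnorm_sq // -wform_shift // wlim_ge0 //.
  by apply: wsummableD => //; exact: wsummableZ.
have x0 : 0 <= wnorm x by exact: sqrtr_ge0.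
have y0 : 0 <= wnorm y by exact: sqrtr_ge0.
move: x0 y0 key; move: (wnorm x) (wnorm y) (Re _) => A B b A0 B0 key.
rewrite leNgt; apply/negP => lt.
have b0 : 0 < b by apply: le_lt_trans lt; rewrite mulr_ge0.
have [B0'|Bp] := eqVneq B 0.
  have := key (- (A ^+ 2 + 1) / (2 * b)).
  rewrite B0' expr0n /= mulr0 addr0.
  rewrite (_ : 2 * _ * b = - (A ^+ 2 + 1)); last by field; rewrite gt_eqF.
  lra.
have Bgt : 0 < B by rewrite lt_neqAle eq_sym Bp.
have := key (- b / B ^+ 2).
rewrite (_ : _ + _ = A ^+ 2 - b ^+ 2 / B ^+ 2); last by field.
rewrite subr_ge0 ler_pdivrMr ?exprn_gt0 // -exprMn ler_pXn2r ?nnegrE ?mulr_ge0 //; last exact: ltW.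
by rewrite leNgt lt.
Qed.

Lemma wnormD x y : wsummable x -> wsummable y ->
  wnorm (fun k => x k + y k) <= wnorm x + wnorm y.
Proof.
move=> hx hy.
have hxy := wsummableD hx hy.
rewrite -(ler_pXn2r (n := 2)) ?nnegrE ?addr_ge0 ?sqrtr_ge0 //.
rewrite wnorm_sq //.
have := wform_shift 1 hx hy.
under eq_fun do rewrite mul1r.
move=> ->; rewrite mulr1 expr1n mul1r -!wnorm_sq //.
have := wformCS hx hy; nra.
Qed.

Lemma wnorm_coef x k : wsummable x ->
  Num.sqrt (w k) * Normc.normc (x k) <= wnorm x.
Proof.
move=> h; rewrite -(ler_pXn2r (n := 2)) ?nnegrE ?mulr_ge0 ?sqrtr_ge0 ?normc_ge0 //.
rewrite exprMn sqr_sqrtr ?(ltW (w_gt0 _)) // wnorm_sq //.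
apply: le_trans (wsummable_le k.+1 h).
rewrite /series /= big_nat_recr //= lerDr sumr_ge0 //.
by move=> i _; exact: wterm_ge0.
Qed.

End wl2.
End seqs.

(* [scale l r] is the Hilbert space of complex sequences x with
   |x|_r ^ 2 = \sum_k l_k ^ (2 r) |x_k| ^ 2 finite. For an orthonormal basis e,
   a sequence x stands for \sum_k x_k e_k. For r >= 0 this gives the subspace of
   H of vectors of finite |.|_r norm; for exponent - r it is the completion of H
   for |.|_(-r): see [hilbert_in_linear], [hilbert_in_norm] and
   [hilbert_in_dense] below, completeness being part of the structure. *)
Definition scale_weight (R : realType) (l : weight_seq R) (r : R) (k : nat) : R :=
  l k `^ (2 * r).

Lemma scale_weight_gt0 (R : realType) (l : weight_seq R) (r : R) k :
  0 < scale_weight l r k.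
Proof. by rewrite powR_gt0 // (lt_trans ltr01) // wt_gt1. Qed.

Definition scale_pred (R : realType) (l : weight_seq R) (r : R) :
  {pred nat -> R[i]^o} := fun x => `[< wsummable (scale_weight l r) x >].

Lemma scale_submod_closed (R : realType) (l : weight_seq R) (r : R) :
  submod_closed (scale_pred l r).
Proof.
have w0 := scale_weight_gt0 l r; split => [|c x y /asboolP hx /asboolP hy].
  by apply/asboolP; exact: wsummable0.
apply/asboolP; apply: (wsummableD w0) => //.
exact: wsummableZ.
Qed.

HB.instance Definition _ (R : realType) (l : weight_seq R) (r : R) :=
  GRing.isSubmodClosed.Build _ _ (scale_pred l r) (scale_submod_closed l r).

Record scale (R : realType) (l : weight_seq R) (r : R) := Scale {
  coef :> nat -> R[i]^o ;
  coefP : scale_pred l r coef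
}.

HB.instance Definition _ (R : realType) (l : weight_seq R) (r : R) :=
  [isSub for @coef R l r].
HB.instance Definition _ (R : realType) (l : weight_seq R) (r : R) :=
  [Choice of scale l r by <:].
HB.instance Definition _ (R : realType) (l : weight_seq R) (r : R) :=
  [SubChoice_isSubLmodule of scale l r by <:].

Section scale_norm.
Context {R : realType} (l : weight_seq R) (r : R).
Local Notation w := (scale_weight l r).
Local Notation w0 := (scale_weight_gt0 l r).
Implicit Types x y : scale l r.

Lemma scale_sum x : wsummable w x.
Proof. exact/asboolP/coefP. Qed.
Arguments scale_sum : clear implicits.

Definition scale_norm x : R[i] := (wnorm w x)%:C.

Lemma scale_normD x y : scale_norm (x + y) <= scale_norm x + scale_norm y.
Proof.
rewrite /scale_norm -rmorphD lecR.
by have := wnormD w0 (scale_sum x) (scale_sum y).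
Qed.

Lemma scale_normZ (c : R[i]) x : scale_norm (c *: x) = `|c| * scale_norm x.
Proof.
rewrite /scale_norm normcE' -rmorphM; congr (_%:C).
exact: (wnormZ c (scale_sum x)).
Qed.

Lemma scale_norm0_eq0 x : scale_norm x = 0 -> x = 0.
Proof.
move=> /complexI h; apply: val_inj.
exact: wnorm_eq0 w0 _ (scale_sum x) h.
Qed.

HB.instance Definition _ := @Lmodule_isNormed.Build R[i] (scale l r)
  scale_norm scale_normD scale_normZ scale_norm0_eq0.

End scale_norm.
Arguments scale_sum {R l r} x.

Section scale_complete.
Context {R : realType} (l : weight_seq R) (r : R).
Local Notation w := (scale_weight l r).
Local Notation w0 := (scale_weight_gt0 l r).
Implicit Types x y : scale l r.

Lemma scale_complete (F : set_system (scale l r)) :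
  ProperFilter F -> cauchy F -> cvg F.
Proof.
move=> FF /cauchy_ballP Fc.
have FN (e : R) : 0 < e ->
    \forall x & y \near F, wnorm w (fun k => coef x k - coef y k) < e.
  move=> e0; have e0' : (0 : R[i]) < e%:C by rewrite ltcR.
  apply: filterS (Fc _ e0') => -[x y] /=.
  by rewrite -ball_normE /= ltcR.
have hC (f : R[i] -> R) k : (forall c, `|f c| <= Normc.normc c) ->
    (forall c d, f (c - d) = f c - f d) ->
    cvg ((fun x : scale l r => f (x k)) @ F).
  move=> f1 f2; apply: R_complete; apply/cauchy_ballP => e e0.
  have s0 : 0 < Num.sqrt (w k) by rewrite sqrtr_gt0 w0.
  have [[A B] /= [FA FB] AB] := FN (e * Num.sqrt (w k)) (mulr_gt0 e0 s0).
  exists ((fun x : scale l r => f (x k)) @` A, (fun x : scale l r => f (x k)) @` B) => /=.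
    split; [apply: filterS FA | apply: filterS FB] => x ? /=; by exists x.
  move=> [_ _] /= [[x Ax <-] [y By <-]].
  rewrite -ball_normE /= -f2.
  apply: le_lt_trans (f1 _) _.
  rewrite -(ltr_pM2l s0) [ltRHS]mulrC.
  apply: le_lt_trans (AB (x, y) (conj Ax By)).
  by have := wnorm_coef w0 k (scale_sum (x - y)).
pose a k := lim ((fun x : scale l r => Re (x k)) @ F).
pose b k := lim ((fun x : scale l r => Im (x k)) @ F).
have ha k : (fun x : scale l r => Re (x k)) @ F --> a k.
  apply: hC; first exact: absRe_le.
  by move=> [? ?] [? ?].
have hb k : (fun x : scale l r => Im (x k)) @ F --> b k.
  apply: hC; first exact: absIm_le.
  by move=> [? ?] [? ?].
pose z : nat -> R[i]^o := fun k => a k +i* b k.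
have hz x n : (fun y : scale l r => series (wterm w (fun k => x k - y k)) n) @ F
    --> series (wterm w (fun k => x k - z k)) n.
  rewrite /series /=; elim: n => [|n IH].
    rewrite big_geq //; under eq_fun do rewrite big_geq //.
    exact: cvg_cst.
  rewrite big_nat_recr //=; under eq_fun do rewrite big_nat_recr //=.
  apply: cvgD; first exact: IH.
  rewrite /wterm normc_sq; under eq_fun do rewrite normc_sq.
  apply: cvgMr; apply: cvgD.
  - rewrite !expr2; under eq_fun do rewrite expr2.
    apply: cvgM; rewrite raddfB /=; under eq_fun do rewrite raddfB /=;
      by apply: cvgB; [exact: cvg_cst | exact: ha].
  - rewrite !expr2; under eq_fun do rewrite expr2.
    apply: cvgM; rewrite raddfB /=; under eq_fun do rewrite raddfB /=;
      by apply: cvgB; [exact: cvg_cst | exact: hb].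
have hb2 (e : R) : 0 < e -> \forall x \near F,
    forall n, series (wterm w (fun k => coef x k - z k)) n <= e ^+ 2.
  move=> e0; have [[A B] /= [FA FB] AB] := FN e e0.
  apply: filterS FA => x Ax n.
  rewrite -(cvg_lim _ (hz x n)) //; apply: limr_le.
    by apply/cvg_ex; exists (series (wterm w (fun k => x k - z k)) n); exact: hz.
  apply: filterS FB => y By.
  have hs := scale_sum (x - y).
  apply: le_trans (wsummable_le w0 n hs) _.
  rewrite -(wnorm_sq w0 hs) ler_pXn2r ?nnegrE ?sqrtr_ge0 ?(ltW e0) //.
  exact: ltW (AB (x, y) (conj Ax By)).
have [x hx] := filter_ex (hb2 1 ltr01).
have xz : wsummable w (fun k => x k - z k) := wsummable_bounded w0 hx.
have zsum : scale_pred l r z.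
  apply/asboolP.
  have := wsummableD w0 (wsummableZ (c := -1) xz) (scale_sum x).
  congr (wsummable _ _); apply/funext => k.
  by rewrite mulN1r opprB subrK.
pose Z : scale l r := Scale zsum.
apply/cvg_ex; exists Z; apply/cvgrPdist_le => e e0.
have [e1 e1E] : exists e1 : R, e = e1%:C.
  exists (Re e); case: e e0 => p q /=; rewrite ltcE /= => /andP[/eqP -> _].
  by [].
have e1p : 0 < e1 by move: e0; rewrite e1E ltcR.
apply: filterS (hb2 _ e1p) => y hy.
rewrite distrC e1E lecR.
have hs := scale_sum (y - Z).
rewrite -(ler_pXn2r (n := 2)) ?nnegrE ?sqrtr_ge0 ?(ltW e1p) //.
rewrite (wnorm_sq w0 hs); apply: limr_le => //.
by apply: nearW => n; exact: hy.
Qed.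

HB.instance Definition _ := @Uniform_isComplete.Build (scale l r) scale_complete.

Definition scale_inner x y : R[i] := wform w x y.

Lemma scale_innerDr x y z :
  scale_inner x (y + z) = scale_inner x y + scale_inner x z.
Proof. exact: (wformDr w0 (scale_sum x) (scale_sum y) (scale_sum z)). Qed.

Lemma scale_innerZr (c : R[i]) x y :
  scale_inner x (c *: y) = c * scale_inner x y.
Proof. exact: (wformZr w0 c (scale_sum x) (scale_sum y)). Qed.

Lemma scale_innerC x y : scale_inner y x = conjc (scale_inner x y).
Proof. exact: (wformC w0 (scale_sum x) (scale_sum y)). Qed.

Lemma scale_innerxx x : scale_inner x x = `|x| ^+ 2.
Proof.
rewrite /scale_inner wformxx -(wnorm_sq w0 (scale_sum x)).
by rewrite rmorphXn.
Qed.

HB.instance Definition _ := @CompleteNormedModule_hasInner.Build R (scale l r)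
  scale_inner scale_innerDr scale_innerZr scale_innerC scale_innerxx.

End scale_complete.

Section dual_space.
Context {R : realType} (l : weight_seq R).

Lemma scale_weight_le (r s : R) k : r <= s ->
  scale_weight l r k <= scale_weight l s k.
Proof.
by move=> rs; rewrite ler_powR ?(ltW (wt_gt1 l k)) // ler_wpM2l.
Qed.

Lemma wsummable_antitone (r s : R) (x : nat -> R[i]) : r <= s ->
  wsummable (scale_weight l s) x -> wsummable (scale_weight l r) x.
Proof.
move=> rs; apply: series_le_cvg => n.
- exact: wterm_ge0 (scale_weight_gt0 l r) x n.
- exact: wterm_ge0 (scale_weight_gt0 l s) x n.
- by rewrite /wterm ler_wpM2r ?sqr_ge0 ?scale_weight_le.
Qed.

(* The dual E^* of the test space, as the union of the spaces E_(-r), r >= 0,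
   inside the space of all coordinate sequences. *)
Definition dual_pred : {pred nat -> R[i]^o} :=
  fun x => `[< exists r : R, 0 <= r /\ wsummable (scale_weight l (- r)) x >].

Lemma dual_submod_closed : submod_closed dual_pred.
Proof.
split => [|c x y /asboolP[r [r0 hx]] /asboolP[s [s0 hy]]].
  by apply/asboolP; exists 0; split; [exact: lexx | exact: wsummable0 (scale_weight_gt0 _ _)].
apply/asboolP; exists (r + s); split; first by rewrite addr_ge0.
apply: (wsummableD (scale_weight_gt0 _ _)).
  by apply: wsummableZ; apply: wsummable_antitone hx; rewrite lerN2 lerDl.
by apply: wsummable_antitone hy; rewrite lerN2 lerDr.
Qed.

HB.instance Definition _ :=
  GRing.isSubmodClosed.Build _ _ dual_pred dual_submod_closed.

Record dual := Dual {
  dcoef :> nat -> R[i]^o ;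
  dcoefP : dual_pred dcoef
}.

HB.instance Definition _ := [isSub for dcoef].
HB.instance Definition _ := [Choice of dual by <:].
HB.instance Definition _ := [SubChoice_isSubLmodule of dual by <:].

Lemma dual_of_subproof (r : R) (r_ge0 : 0 <= r) (x : scale l (- r)) :
  dual_pred x.
Proof. by apply/asboolP; exists r; split => //; exact: scale_sum. Qed.

Definition dual_of (r : R) (r_ge0 : 0 <= r) (x : scale l (- r)) : dual :=
  Dual (dual_of_subproof r_ge0 x).

(* Neighbourhoods of 0 and convergence for the locally convex inductive limit
   topology: V absolutely convex is a neighbourhood of 0 iff its trace on every
   step E_(-r) is one. *)
Definition abs_convex (V : set dual) : Prop :=
  forall (c d : R[i]) x y, `|c| + `|d| <= 1 -> V x -> V y -> V (c *: x + d *: y).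

Definition dual_nbhs0 (U : set dual) : Prop :=
  exists V : set dual, [/\ abs_convex V,
    forall (r : R) (r_ge0 : 0 <= r),
      \forall x \near (0 : scale l (- r)), V (dual_of r_ge0 x)
    & V `<=` U].

Definition dual_cvg (x : nat -> dual) (s : dual) : Prop :=
  forall U, dual_nbhs0 U -> \forall N \near \oo, U (x N - s).

End dual_space.

Section test_space.
Context {R : realType} {H : hilbertType R} (e : nat -> H) (l : weight_seq R).

(* [inner] is linear in its second argument, so that
   h = \sum_k (coords h k) e_k. *)
Definition coords (h : H) : nat -> R[i]^o := fun k => inner (e k) h.

Definition test_space : set H :=
  [set xi | forall r : R, 0 <= r -> wsummable (scale_weight l r) (coords xi)].

(* The canonical bilinear (not sesquilinear) pairing of E^* with the test space;
   the series converges absolutely on the test space, see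
   [pairing_abs_summable]. *)
Definition pairing (x : dual l) (xi : H) : R[i] :=
  csum (fun k => x k * coords xi k).

Hypothesis e_basis : orthonormal_basis e.

Let inner0r (x : H) : inner x 0 = 0.
Proof. by have := innerZr 0 x x; rewrite scale0r mul0r. Qed.

Let innerNr (x y : H) : inner x (- y) = - inner x y.
Proof. by rewrite -scaleN1r innerZr mulN1r. Qed.

Let innerDl (x y z : H) : inner (x + y) z = inner x z + inner y z.
Proof. by rewrite innerC innerDr rmorphD /= -!innerC. Qed.

Let innerZl (c : R[i]) (x y : H) : inner (c *: x) y = conjc c * inner x y.
Proof. by rewrite innerC innerZr rmorphM /= -innerC. Qed.

Let inner_sumr (x : H) n (f : nat -> H) :
  inner x (\sum_(0 <= k < n) f k) = \sum_(0 <= k < n) inner x (f k).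
Proof.
elim: n => [|n IH]; first by rewrite !big_geq // inner0r.
by rewrite !big_nat_recr //= innerDr IH.
Qed.

Lemma coords_sum n (c : nat -> R[i]) k :
  coords (\sum_(0 <= j < n) c j *: e j) k = if (k < n)%N then c k else 0.
Proof.
rewrite /coords inner_sumr.
under eq_bigr do rewrite innerZr (proj1 e_basis).
elim: n => [|n IH]; first by rewrite big_geq.
rewrite big_nat_recr //= IH ltnS [in RHS]leq_eqVlt.
case: (ltngtP k n) => [kn|nk|<-] /=; rewrite ?mulr0 ?addr0 //.
by rewrite mulr1 add0r.
Qed.

Lemma coords_basis j k : coords (e j) k = (j == k)%:R.
Proof. by rewrite /coords (proj1 e_basis) eq_sym. Qed.

Lemma basis_test j : test_space (e j).
Proof.
move=> r r0; apply: (@wsummable_bounded _ _ (scale_weight_gt0 l r) _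
  (scale_weight l r j)) => n.
rewrite /series /= (_ : \sum_(0 <= k < n) _ =
  if (j < n)%N then scale_weight l r j else 0).
  by case: ifP => // _; exact: ltW (scale_weight_gt0 l r j).
elim: n => [|n IH]; first by rewrite big_geq.
rewrite big_nat_recr //= IH /wterm coords_basis normc_sq ltnS.
case: (ltngtP j n) => [jn|nj|<-] /=; rewrite expr0n /= ?expr0n ?expr1n /=.
- by rewrite !(addr0, mulr0).
- by rewrite !(addr0, mulr0).
- by rewrite ?leqnn add0r addr0 mulr1.
Qed.

Lemma bessel (h : H) n :
  series (fun k => Normc.normc (coords h k) ^+ 2) n <= complex.Re (inner h h).
Proof.
pose s := \sum_(0 <= k < n) coords h k *: e k.
have hs : inner s s = (series (fun k => Normc.normc (coords h k) ^+ 2) n)%:C.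
  rewrite {2}/s inner_sumr /series /= rmorph_sum /=.
  rewrite big_nat_cond [RHS]big_nat_cond; apply: eq_bigr => k /andP[/andP[_ kn] _].
  rewrite innerZr innerC -/(coords s k) coords_sum kn.
  by rewrite -sqr_normc normcE' rmorphXn.
have hh : inner s h = inner s s.
  have -> : inner s h = conjc (inner h s) by rewrite innerC.
  rewrite {1}/s inner_sumr rmorph_sum /= hs /series /= rmorph_sum /=.
  apply: eq_bigr => k _.
  rewrite innerZr rmorphM /= (innerC (e k) h) -/(coords h k) conjcK mulrC.
  by rewrite -sqr_normc normcE' rmorphXn.
have := sqr_ge0 (Re `|h - s|).
have -> : complex.Re `|h - s| ^+ 2 = complex.Re (inner (h - s) (h - s)).
  by rewrite innerxx; move: (normr_ge0 (h - s)); case: (`|h - s|) => p q;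
   rewrite lecE /= => /andP[/eqP -> _]; ring.
have innerNl (x y : H) : inner (- x) y = - inner x y.
  by rewrite innerC innerNr rmorphN /= -innerC.
rewrite innerDr innerNr !innerDl !innerNl (innerC s h) hh hs /=.
by case: (inner h h) => p q /=; lra.
Qed.

Lemma coords_scale (r : R) (h : H) : 0 <= r -> scale_pred l (- r) (coords h).
Proof.
move=> r0; apply/asboolP.
apply: (wsummable_bounded (scale_weight_gt0 l (- r)) (B := Re (inner h h))) => n.
apply: le_trans (bessel h n); rewrite /series /=; apply: ler_sum => k _.
rewrite /wterm -[leRHS]mul1r ler_wpM2r ?sqr_ge0 //.
by have := @scale_weight_le _ l (- r) 0 k; rewrite {2}/scale_weight mulr0 powRr0;
  apply; rewrite oppr_le0.
Qed.

Definition hilbert_in (r : R) (r_ge0 : 0 <= r) (h : H) : scale l (- r) :=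
  Scale (coords_scale h r_ge0).

Lemma hilbert_in_linear (r : R) (r_ge0 : 0 <= r) (c : R[i]) (g h : H) :
  hilbert_in r_ge0 (c *: g + h) = c *: hilbert_in r_ge0 g + hilbert_in r_ge0 h.
Proof.
by apply: val_inj; apply/funext => k; rewrite /= /coords innerDr innerZr.
Qed.

Lemma hilbert_in_norm (r : R) (r_ge0 : 0 <= r) (h : H) :
  `|hilbert_in r_ge0 h| = (Num.sqrt (limn (series
    (fun k => l k `^ (2 * - r) * Normc.normc (inner (e k) h) ^+ 2))))%:C.
Proof. by []. Qed.

Lemma hilbert_in_dense (r : R) (r_ge0 : 0 <= r) :
  closure (range (hilbert_in r_ge0)) = setT.
Proof.
apply/seteqP; split => // x _ B /nbhs_ballP[d /= d0 dB].
have w0 := scale_weight_gt0 l (- r).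
have [d1 dE] : exists d1 : R, d = d1%:C.
  exists (Re d); case: d d0 {dB} => p q /=; rewrite ltcE /= => /andP[/eqP -> _].
  by [].
have d1p : 0 < d1 by move: d0; rewrite dE ltcR.
have hx := scale_sum x.
pose L := limn (series (wterm (scale_weight l (- r)) x)).
have [n hn] : exists n, L - series (wterm (scale_weight l (- r)) x) n < d1 ^+ 2.
  have /cvgrPdist_lt /(_ _ (exprn_gt0 2 d1p)) [n _ /(_ n (leqnn n)) /= h] := hx.
  by exists n; apply: le_lt_trans h; exact: ler_norm.
pose y := hilbert_in r_ge0 (\sum_(0 <= j < n) x j *: e j).
exists y; split; first by exists (\sum_(0 <= j < n) x j *: e j).
apply: dB; rewrite -ball_normE /= dE ltcR.
have hs := scale_sum (x - y).
rewrite -(ltr_pXn2r (n := 2)) ?nnegrE ?sqrtr_ge0 ?(ltW d1p) //.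
rewrite (wnorm_sq w0 hs); apply: le_lt_trans hn; apply: limr_le => //.
exists n => // m /= nm.
apply: (@le_trans _ _ (series (wterm (scale_weight l (- r)) x) m -
  series (wterm (scale_weight l (- r)) x) n)); last first.
  by rewrite lerD2r; exact: (wsummable_le w0 m hx).
have wk : wterm (scale_weight l (- r)) (x - y) =
    fun k => if (k < n)%N then 0 else wterm (scale_weight l (- r)) x k.
  apply/funext => k.
  have yk : coef (x - y) k = x k - (if (k < n)%N then x k else 0).
    by rewrite -(coords_sum n x).
  rewrite /wterm yk; case: ifP => _; last by rewrite subr0.
  by rewrite subrr normc_sq /= expr0n addr0 mulr0.
rewrite wk sub_series_geq // /series /= (@big_cat_nat _ _ _ n) //= big1_seq.
  rewrite add0r big_nat_cond [leRHS]big_nat_cond; apply: ler_sum => k.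
  by move=> /andP[/andP[nk _] _]; rewrite ltnNge nk.
by move=> k /andP[_]; rewrite mem_index_iota => /andP[_ ->].
Qed.

Lemma pairing_abs_summable (x : dual l) xi : test_space xi ->
  abs_summable (fun k => x k * coords xi k).
Proof.
have /asboolP[r [r0 hx]] := dcoefP x => /(_ r r0) hxi.
have w0 := scale_weight_gt0 l.
apply: (@series_le_cvg _ _ (wterm (scale_weight l (- r)) x +
  wterm (scale_weight l r) (coords xi))).
- by move=> n; exact: normc_ge0.
- by move=> n; rewrite addr_ge0 // wterm_ge0.
- move=> n; apply: (@le_trans _ _ (wterm (scale_weight l (- r)) x n +
    wterm (scale_weight l r) (coords xi) n)) => //.
  rewrite Normc.normcM /wterm /scale_weight mulrN powRN.
  have := w0 r n; rewrite /scale_weight.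
  have := normc_ge0 (x n); have := normc_ge0 (coords xi n).
  move: (Normc.normc _) (Normc.normc _) (_ `^ _) => u v s u0 v0 s0.
  have -> : s^-1 * u ^+ 2 + s * v ^+ 2 =
      u * v + s^-1 * ((u - s * v) ^+ 2 + s * (u * v)).
    by field; rewrite gt_eqF.
  rewrite lerDl mulr_ge0 ?invr_ge0 ?(ltW s0) // addr_ge0 ?sqr_ge0 //.
  by rewrite !mulr_ge0 // ltW.
- exact: is_cvg_seriesD.
Qed.

Lemma pairing_basis (x : dual l) j : pairing x (e j) = x j.
Proof.
have key (f : R[i] -> R) : f 0 = 0 ->
    limn (series (fun k => f (x k * coords (e j) k))) = f (x j).
  move=> f0; apply/cvg_lim => //; apply: cvg_near_cst.
  exists j.+1 => // n /= jn; rewrite /series /=.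
  rewrite (bigD1_seq j) ?iota_uniq ?mem_index_iota //= coords_basis eqxx mulr1.
  rewrite big1 ?addr0 // => k kj.
  by rewrite coords_basis eq_sym (negbTE kj) mulr0.
by rewrite /pairing /csum !key //; case: (x j).
Qed.

End test_space.

Section tensor.
Context {R : realType}.

Definition lin_span (T : lmodType R[i]) (A : set T) : set T :=
  [set t | exists (m : nat) (c : 'I_m -> R[i]) (v : 'I_m -> T),
    (forall i, A (v i)) /\ t = \sum_i c i *: v i].

Definition upd (V : Type) (n : nat) (x : 'I_n -> V) (i : 'I_n) (v : V) :
  'I_n -> V := fun j => if j == i then v else x j.

(* T is the Hilbert space completion of the n-th algebraic tensor power of V
   for the product inner product; this determines (T, tens) up to a unique
   isometric isomorphism compatible with pure tensors. *)
Record hilbert_tensor_power (V T : hilbertType R) (n : nat)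
    (tens : ('I_n -> V) -> T) : Prop := {
  tens_multilinear : forall x i (c : R[i]) v w,
    tens (upd x i (c *: v + w)) = c *: tens (upd x i v) + tens (upd x i w) ;
  tens_inner : forall x y,
    inner (tens x) (tens y) = \prod_i inner (x i) (y i) ;
  tens_dense : closure (lin_span (range tens)) = setT
}.

(* Embeds the coefficient space [scale l r], r >= 0, into a Hilbert space with
   orthonormal basis u. *)
Definition basis_sum (V : hilbertType R) (u : nat -> V) (l : weight_seq R)
    (r : R) (x : scale l r) : V :=
  limn (series (fun k => x k *: u k)).

(* Unconditional sum: limit along the directed set of finite subsets of I. *)
Definition has_sum (I : choiceType) (V : hilbertType R) (f : I -> V) (s : V) :
  Prop := (fun F : {fset I} => \sum_(k <- F) f k) @ totally --> s.

End tensor.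

(* Main.v *)
(** The orthogonal family [d k] of tensors of the [e_(a,k)] in the [n]-th tensor
    power of [N_(a,1)] satisfies [b_k f = |d k|^-2 <d k, f>], and the sum of the
    [|d k|^-2] is the [n]-th power of the convergent sum of the
    [lambda_(a,k)^-2].  Testing against the finite combinations of the
    [|d k|^-2 d k] with unimodular coefficients bounds the sum of the [|b_k f|]
    by a multiple of [|f|]; with (C2), the series defining [i f] converges
    absolutely and [i] is bounded.

    For injectivity, let [adj] be the adjoint of the one-variable map
    [e_(a,k) |-> e_(a,k)] from [N_(a,1)] to [E_(-p)].  Then [i f] pairs with
    [tE (y_1, .., y_n)] as [f] does with [tN (adj y_1, .., adj y_n)].  If
    [i f = 0], the [adj y_j] can be replaced by arbitrary vectors one slot at a
    time: a bounded functional [phi] on [N_(a,1)] that vanishes on the range of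
    [adj] yields an l1 relation between the [e_(a,k)] with coefficients
    [lambda_(a,k)^-2 conj (phi e_(a,k))], so it is zero by (C3).  Hence [f] is
    orthogonal to all pure tensors. *)

Require Import Defs.
From HB Require Import structures.
From mathcomp Require Import all_boot all_order all_algebra.
From mathcomp Require Import all_classical all_reals all_analysis.
From mathcomp Require Import complex.
From mathcomp Require Import finmap lra.
From mathcomp Require Import summability.
Set Implicit Arguments.
Unset Strict Implicit.
Unset Printing Implicit Defensive.
Import Order.TTheory GRing.Theory Num.Theory numFieldNormedType.Exports.
Local Open Scope classical_set_scope.
Local Open Scope ring_scope.
Local Open Scope complex_scope.

(** * Bounded linear maps and their kernels *)

Section bounded_linear.
Context {R : realType}.
Implicit Types V W : normedModType R[i].

(** Bundles a map with its linearity proof, so that [linear_sum] and [linearZ] apply. *)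
Lemma ex_linear (V W : lmodType R[i]) (f : V -> W) :
  linear f -> exists g : {linear V -> W}, g =1 f.
Proof.
move=> lf; pose F := GRing.isLinear.Build R[i] V W *:%R f lf.
by exists (HB.pack f F : {linear V -> W}).
Qed.

Lemma linear_bound_continuous V W (f : V -> W) (C : R[i]) :
  linear f -> (forall x, `|f x| <= C * `|x|) -> continuous f.
Proof.
move=> lf fC.
have fB x y : f (x - y) = f x - f y.
  by rewrite addrC -scaleN1r lf scaleN1r addrC.
move=> x; apply/cvgrPdist_lt => eps e0.
(* [C] is an arbitrary scalar: [|C| + 1] is a positive constant to divide by, and the bound itself
   forces [0 <= C] as soon as [x] and [y] differ. *)
have C0 : 0 < `|C| + 1 by rewrite ltr_wpDl.
near=> y.
rewrite -fB; apply: le_lt_trans (fC _) _.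
apply: (@le_lt_trans _ _ ((`|C| + 1) * `|x - y|)).
  have [->|xy] := eqVneq `|x - y| 0; first by rewrite !mulr0.
  have xy0 : 0 < `|x - y| by rewrite lt_neqAle eq_sym xy normr_ge0.
  have C00 : 0 <= C by rewrite -(pmulr_lge0 _ xy0); apply: le_trans (fC _).
  by rewrite ler_pM2r // ger0_norm // lerDl.
rewrite mulrC -ltr_pdivlMr //.
near: y; apply: cvgr_dist_lt => //; exact: divr_gt0.
Unshelve. all: by end_near. Qed.

(** The kernel of [f] is closed and contains the span of [A]. This allows identities between
    continuous linear maps to be checked on generators only. *)
Lemma linear_zero_closed V W (f : V -> W) (A : set V) :
  linear f -> continuous f -> (forall x, A x -> f x = 0) ->
  forall x, closure (lin_span A) x -> f x = 0.
Proof.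
move=> lf cf fA.
have [g gf] := ex_linear lf.
have spanA : lin_span A `<=` f @^-1` [set 0].
  move=> _ [m [c [v [Av ->]]]] /=; rewrite -gf linear_sum big1 // => i _.
  by rewrite linearZ /= gf fA // scaler0.
have cl : closed (f @^-1` [set 0]).
  apply: closed_comp => [? _|]; first exact: cf.
  exact: accessible_closed_set1 (hausdorff_accessible (@norm_hausdorff _ _)) _.
by move=> x /(closure_subset spanA); rewrite -(proj1 (closure_id _) cl).
Qed.

End bounded_linear.

(** * Inner products: Cauchy-Schwarz and continuity *)

Section inner_product.
Context {R : realType} (V : hilbertType R).
Implicit Types x y z : V.

Lemma inner0r x : inner x (0 : V) = 0.
Proof. by have := innerZr 0 x (0 : V); rewrite scale0r mul0r. Qed.

Lemma innerNr x y : inner x (- y) = - inner x y.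
Proof. by rewrite -scaleN1r innerZr mulN1r. Qed.

Lemma innerDl x y z : inner (x + y) z = inner x z + inner y z.
Proof. by rewrite innerC innerDr rmorphD /= -!innerC. Qed.

Lemma innerZl (c : R[i]) x y : inner (c *: x) y = conjc c * inner x y.
Proof. by rewrite innerC innerZr rmorphM /= -innerC. Qed.

Lemma inner0l x : inner (0 : V) x = 0.
Proof. by rewrite innerC inner0r rmorph0. Qed.

Lemma innerNl x y : inner (- x) y = - inner x y.
Proof. by rewrite innerC innerNr rmorphN /= -innerC. Qed.

Lemma inner_linear x : linear (inner x : V -> R[i]^o).
Proof. by move=> c y z; rewrite innerDr innerZr. Qed.

Lemma inner_sumr x (I : Type) (s : seq I) (P : pred I) (f : I -> V) :
  inner x (\sum_(k <- s | P k) f k) = \sum_(k <- s | P k) inner x (f k).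
Proof. exact: (big_morph _ (innerDr x) (inner0r x)). Qed.

Lemma inner_suml x (I : Type) (s : seq I) (P : pred I) (f : I -> V) :
  inner (\sum_(k <- s | P k) f k) x = \sum_(k <- s | P k) inner (f k) x.
Proof.
exact: (big_morph (fun y => inner y x) (fun y z => innerDl y z x) (inner0l x)).
Qed.

Lemma inner_self_eq0 x : inner x x = 0 -> x = 0.
Proof. by rewrite innerxx => /eqP; rewrite sqrf_eq0 normr_eq0 => /eqP. Qed.

Lemma norm_inner_le x y : `|inner x y| <= `|x| * `|y|.
Proof.
have [->|y0] := eqVneq y 0; first by rewrite inner0r !normr0 mulr0.
have Y0 : 0 < `|y| by rewrite normr_gt0.
(* [c *: y] is the orthogonal projection of [x] on [y]; the inequality expresses that the remainder
   [x - c *: y] has nonnegative squared norm. *)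
pose c := inner y x / `|y| ^+ 2.
have cY : c * `|y| ^+ 2 = inner y x by rewrite divfK // expf_neq0 // gt_eqF.
have : 0 <= inner (x - c *: y) (x - c *: y) by rewrite innerxx exprn_ge0.
have ycy : inner y (x - c *: y) = 0.
  by rewrite innerDr innerNr innerZr [inner y y]innerxx cY subrr.
rewrite innerDl innerNl innerZl ycy mulr0 subr0 innerDr innerNr innerZr.
rewrite innerxx subr_ge0.
rewrite -(ler_pM2r (exprn_gt0 2 Y0)) mulrAC cY.
by rewrite (innerC x y) mulrC -sqr_normc -exprMn ler_pXn2r // nnegrE mulr_ge0.
Qed.

Lemma inner_continuous x : continuous (inner x : V -> R[i]^o).
Proof.
apply: (linear_bound_continuous (C := `|x|)) (inner_linear x) _.
exact: norm_inner_le.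
Qed.

End inner_product.

(** * Finite sums and unconditional sums *)

Section summation.
Context {R : realType}.

Lemma ger0_Re (x : R[i]) : 0 <= x -> x = (complex.Re x)%:C.
Proof. by case: x => a b; rewrite lecE /= => /andP[/eqP -> _]. Qed.

Lemma conjc_ge0 (x : R[i]) : 0 <= x -> conjc x = x.
Proof. by move=> /ger0_Re ->; rewrite /= oppr0. Qed.

Lemma big_uniq_subset (I : eqType) (T : nmodType) (f : I -> T) (A B : seq I) :
  uniq A -> uniq B -> {subset A <= B} ->
  \sum_(k <- B) f k = \sum_(k <- A) f k + \sum_(k <- B | k \notin A) f k.
Proof.
move=> uA uB AB; rewrite (bigID (mem A)) /=; congr (_ + _).
rewrite -big_filter; apply: perm_big; apply: uniq_perm => //.
  by rewrite filter_uniq.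
by move=> k; rewrite mem_filter; case: (boolP (k \in A)) => //= /AB.
Qed.

Lemma big_fset_subset (I : choiceType) (T : nmodType) (f : I -> T)
    (A B : {fset I}) : (A `<=` B)%fset ->
  \sum_(k <- B) f k = \sum_(k <- A) f k + \sum_(k <- B | k \notin A) f k.
Proof. by move=> /fsubsetP AB; apply: big_uniq_subset. Qed.

Lemma ler_sum_uniq_subset (I : eqType) (K : numDomainType) (f : I -> K)
    (A B : seq I) :
  (forall k, 0 <= f k) -> uniq A -> uniq B -> {subset A <= B} ->
  \sum_(k <- A) f k <= \sum_(k <- B) f k.
Proof.
by move=> f0 uA uB AB; rewrite (big_uniq_subset f uA uB AB) lerDl sumr_ge0.
Qed.

Lemma sum_uniq_le (q : nat -> R) (L : R) (s : seq nat) :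
  (forall k, 0 <= q k) -> (forall m, series q m <= L) -> uniq s ->
  \sum_(k <- s) q k <= L.
Proof.
move=> q0 qL us; apply: le_trans (qL (\max_(k <- s) k.+1)%N).
apply: ler_sum_uniq_subset => //; first exact: iota_uniq.
move=> k ks; rewrite mem_index_iota leq0n /=.
exact: (@leq_bigmax_seq _ _ xpredT (fun k => k.+1)).
Qed.

(** A finite set of multi-indices lies in a cube of side [m], over which the sum of the products
    factors as the [n]-th power of a partial sum of [q]. *)
Lemma sum_prod_le (n : nat) (q : nat -> R) (L : R)
    (s : seq {ffun 'I_n -> nat}) :
  (forall k, 0 <= q k) -> (forall m, series q m <= L) -> uniq s ->
  \sum_(k <- s) \prod_j q (k j) <= L ^+ n.
Proof.
move=> q0 qL us; pose m := (\max_(k <- s) \max_j (k j).+1)%N.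
pose emb (g : {ffun 'I_n -> 'I_m}) := [ffun j => g j : nat].
have embI : injective emb.
  move=> g h /ffunP gh; apply/ffunP => j; apply: val_inj.
  by have := gh j; rewrite !ffunE.
apply: (@le_trans _ _ (\sum_(k <- map emb (enum {ffun 'I_n -> 'I_m}))
    \prod_j q (k j))).
  apply: ler_sum_uniq_subset => //.
  - by move=> k; rewrite prodr_ge0.
  - by rewrite map_inj_uniq // enum_uniq.
  - move=> k ks; apply/mapP.
    have km j : (k j < m)%N.
      apply: leq_trans (@leq_bigmax _ (fun j => (k j).+1) j) _.
      exact: (@leq_bigmax_seq _ s xpredT
        (fun k : {ffun 'I_n -> nat} => \max_j (k j).+1)%N).
    exists [ffun j => Ordinal (km j)]; first by rewrite mem_enum.
    by apply/ffunP => j; rewrite !ffunE.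
rewrite big_map big_enum /=.
under eq_bigr do under eq_bigr do rewrite ffunE.
rewrite -(bigA_distr_bigA (fun=> q \o val)) /= prodr_const card_ord.
have := qL m; rewrite /series /= big_mkord => qm.
by rewrite lerXn2r // nnegrE ?sumr_ge0 // (le_trans _ qm) ?sumr_ge0.
Qed.

(** Once [F0] brings the sum of norms within [d] of its supremum, the terms outside [F0] have total
    norm below [d]; hence the net of finite sums is Cauchy. *)
Lemma abs_has_sum (I : choiceType) (V : hilbertType R) (f : I -> V)
    (B : R[i]) :
  (forall F : {fset I}, \sum_(k <- F) `|f k| <= B) -> exists s, has_sum f s.
Proof.
move=> fB; have tF := @totally_filter I.
pose r (F : {fset I}) := complex.Re (\sum_(k <- F) `|f k|).
have rE (F : {fset I}) : \sum_(k <- F) `|f k| = (r F)%:C.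
  by apply: ger0_Re; exact: sumr_ge0.
have rsup : has_sup (range r).
  split; first by exists (r fset0), fset0.
  exists (complex.Re B) => _ [F _ <-].
  by have := fB F; rewrite rE lecE => /andP[].
suff /cauchy_cvg/cvg_ex[s hs] :
    cauchy ((fun F : {fset I} => \sum_(k <- F) f k) @ totally) by exists s.
apply: cauchy_exP => d d0.
have d1 : 0 < complex.Re d by rewrite -ltcR -ger0_Re // ltW.
have [_ [F0 _ <-] hF0] := sup_adherent d1 rsup.
exists (\sum_(k <- F0) f k); exists F0 => // F /= F0F.
rewrite -ball_normE /= (big_fset_subset f F0F) opprD addNKr normrN.
apply: le_lt_trans (ler_norm_sum _ _ _) _.
have -> : \sum_(k <- F | k \notin F0) `|f k| = (r F - r F0)%:C.
  rewrite rmorphB /= -!rE (big_fset_subset (fun k => `|f k|) F0F).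
  by rewrite addrAC subrr add0r.
rewrite (ger0_Re (ltW d0)) ltcR ltrBlDr -ltrBlDl.
apply: le_lt_trans hF0; rewrite lerD2r.
by apply: ub_le_sup; [case: rsup | exists F].
Qed.

Lemma has_sum_unique (I : choiceType) (V : hilbertType R) (f : I -> V) s t :
  has_sum f s -> has_sum f t -> s = t.
Proof.
have tF := @totally_filter I.
by move=> fs ft; exact: (cvg_unique (@norm_hausdorff _ _) fs ft).
Qed.

Lemma has_sum_norm_le (I : choiceType) (V : hilbertType R) (f : I -> V) s
    (B : R[i]) :
  has_sum f s -> (forall F : {fset I}, \sum_(k <- F) `|f k| <= B) -> `|s| <= B.
Proof.
have tF := @totally_filter I.
move=> /cvgrPdist_lt fs fB; apply/ler_addgt0Pr => d d0.
have [F hF] := filter_ex (fs d d0).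
rewrite -(subrK (\sum_(k <- F) f k) s) addrC.
apply: le_trans (ler_normD _ _) _; apply: lerD; last exact: ltW.
exact: le_trans (ler_norm_sum _ _ _) (fB F).
Qed.

Lemma has_sum_finite (I : choiceType) (V : hilbertType R) (f : I -> V)
    (F0 : {fset I}) :
  (forall k, k \notin F0 -> f k = 0) -> has_sum f (\sum_(k <- F0) f k).
Proof.
have tF := @totally_filter I.
move=> f0; apply: cvg_near_cst; exists F0 => // F /= F0F.
by rewrite (big_fset_subset f F0F) [X in _ + X]big1 ?addr0.
Qed.

Lemma has_sum_linear (I : choiceType) (V : hilbertType R) (c : R[i])
    (f g : I -> V) s t :
  has_sum f s -> has_sum g t -> has_sum (fun k => c *: f k + g k) (c *: s + t).
Proof.
have tF := @totally_filter I.
move=> fs gt; rewrite /has_sum.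
under eq_fun do rewrite big_split -scaler_sumr /=.
by apply: cvgD gt; apply: cvgZr.
Qed.

(** Every finite subset of [nat] is contained in all large enough initial segments. *)
Lemma has_sum_series (V : hilbertType R) (f : nat -> V) s :
  has_sum f s -> series f @ \oo --> s.
Proof.
move=> fs; apply: cvg_trans fs => A [F0 _ hF0].
exists (\max_(k <- F0) k.+1)%N => // n /= nF.
have -> : series f n = \sum_(k <- [fset k in iota 0 n]%fset) f k.
  rewrite /series /=; apply: perm_big; apply: uniq_perm => //.
  - by rewrite iota_uniq.
  - exact: fset_uniq.
  - by move=> k; rewrite /index_iota subn0 !inE.
apply: hF0; apply/fsubsetP => k kF; rewrite /= !inE mem_iota add0n.
by apply: leq_trans nF; exact: (@leq_bigmax_seq _ _ xpredT (fun k => k.+1)).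
Qed.

End summation.

(** Duality: [phi] is tested on a combination [v] of the [g k] whose phases make [phi v] equal to
    the sum to be bounded, while orthogonality gives [|v| <= B]. *)
Lemma orthogonal_l1_le (R : realType) (V : hilbertType R) (I : eqType)
    (g : I -> V) (w : I -> R[i]) (phi : V -> R[i]^o) (C B : R[i]) (s : seq I) :
  linear phi -> (forall v, `|phi v| <= C * `|v|) -> 0 <= C ->
  (forall k, 0 < w k) ->
  (forall j k, inner (g j) (g k) = (j == k)%:R * w k) ->
  uniq s -> 0 <= B -> \sum_(k <- s) (w k)^-1 <= B ^+ 2 ->
  \sum_(k <- s) `|(w k)^-1 * phi (g k)| <= C * B.
Proof.
move=> lphi phiC C0 w0 gg us B0 wB.
have [psi psiE] := ex_linear lphi.
pose z k := (w k)^-1 * phi (g k).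
(* Division by zero yields [0], so [th k] vanishes where [z k] does and is unimodular elsewhere. *)
pose th k := `|z k| / z k.
have thz k : th k * z k = `|z k|.
  rewrite /th; have [->|zk] := eqVneq (z k) 0; first by rewrite normr0 mulr0.
  by rewrite divfK.
have th1 k : conjc (th k) * th k <= 1.
  rewrite mulrC -sqr_normc /th normrM normr_id normfV.
  have [->|zk] := eqVneq `|z k| 0; first by rewrite mul0r expr0n /= ler01.
  by rewrite divff // expr1n.
pose v := \sum_(k <- s) (th k * (w k)^-1) *: g k.
have gv k : k \in s -> inner (g k) v = th k.
  move=> ks; rewrite /v inner_sumr (bigD1_seq k) //= big1 ?addr0.
    by rewrite innerZr gg eqxx mul1r divfK // gt_eqF.
  by move=> j /negbTE jk; rewrite innerZr gg eq_sym jk mul0r mulr0.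
have vB : `|v| <= B.
  rewrite -(ler_pXn2r (n := 2)) ?nnegrE // -innerxx.
  apply: le_trans wB; rewrite {1}/v inner_suml big_seq [leRHS]big_seq.
  apply: ler_sum => k ks; rewrite innerZl gv // rmorphM /= mulrAC.
  have wr : conjc (w k)^-1 = (w k)^-1.
    by apply: conjc_ge0; rewrite invr_ge0 ltW.
  by rewrite wr -[leRHS]mul1r ler_wpM2r // invr_ge0 ltW.
have psiv : phi v = \sum_(k <- s) `|z k|.
  rewrite -psiE linear_sum; apply: eq_bigr => k _.
  by rewrite -thz /z linearZ /= psiE mulrA.
(* [phi v] is a nonnegative real, hence equal to its own norm. *)
rewrite -[leLHS]psiv -[leLHS]ger0_norm; last by rewrite psiv sumr_ge0.
by apply: le_trans (phiC v) _; exact: ler_wpM2l.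
Qed.

(** * The orthogonal basis of a weighted sequence space *)

Section scale_basis.
Context {R : realType} (l : weight_seq R) (r : R).
Local Notation w := (scale_weight l r).
Local Notation w0 := (scale_weight_gt0 l r).

Lemma scale_unit_subproof (k : nat) : scale_pred l r (fun j => (j == k)%:R).
Proof.
apply/asboolP; apply: (wsummable_bounded w0 (B := w k)) => n.
have wE : wterm w (fun j => (j == k)%:R : R[i]^o) =
    fun j => if j == k then w k else 0.
  apply/funext => j; rewrite /wterm normc_sq; case: eqP => [->|_] /=.
    by rewrite expr1n expr0n addr0 mulr1.
  by rewrite expr0n addr0 mulr0.
rewrite wE /series /= -big_mkcond /=.
elim: n => [|n IH]; first by rewrite big_geq // ltW // w0.
rewrite big_mkcond big_nat_recr //= -big_mkcond /=.
case: eqP => [->|_]; last by rewrite addr0.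
rewrite big_nat_cond big1 ?add0r // => j.
by move=> /andP[/andP[_ jk] /eqP jE]; rewrite jE ltnn in jk.
Qed.

Definition scale_unit k : scale l r := Scale (scale_unit_subproof k).

Lemma inner_scale_unit k (x : scale l r) :
  inner (scale_unit k) x = (w k)%:C * x k.
Proof.
(* [f] stands for [Re] and [Im]; only the [k]-th term survives, so the partial sums are constant
   from [k.+1] on. *)
have key (f : R[i] -> R) : f 0 = 0 ->
    limn (series (fun j => f ((w j)%:C * conjc (scale_unit k j) * x j)))
    = f ((w k)%:C * x k).
  move=> f0; apply/cvg_lim => //; apply: cvg_near_cst.
  exists k.+1 => // n /= kn; rewrite /series /=.
  rewrite (bigD1_seq k) ?iota_uniq ?mem_index_iota //= eqxx.
  rewrite rmorph1 mulr1 big1 ?addr0 // => j /negbTE ->.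
  by rewrite rmorph0 mulr0 mul0r.
rewrite [LHS]/(csum _) /csum !key //.
by case: (_ * _).
Qed.

Lemma inner_scale_units j k :
  inner (scale_unit j) (scale_unit k) = (j == k)%:R * (w k)%:C.
Proof.
rewrite inner_scale_unit /=; case: eqP => [->|_]; first exact: mulrC.
by rewrite mulr0 mul0r.
Qed.

Lemma coef_sum (I : Type) (s : seq I) (P : pred I) (f : I -> scale l r) k :
  coef (\sum_(i <- s | P i) f i) k = \sum_(i <- s | P i) coef (f i) k.
Proof. by elim/big_rec2: _ => // i y x _ <-. Qed.

Lemma coef_series_unit (x : scale l r) n k :
  coef (series (fun j => x j *: scale_unit j) n) k
  = if (k < n)%N then x k else 0.
Proof.
rewrite /series /= coef_sum.
elim: n => [|n IH]; first by rewrite big_geq.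
rewrite big_nat_recr //= IH ltnS [in RHS]leq_eqVlt.
rewrite -[X in _ + X]/(x n * (k == n)%:R).
by case: (ltngtP k n) => [kn|nk|->] /=; rewrite ?mulr0 ?addr0 // mulr1 add0r.
Qed.

Lemma scale_unit_expansion (x : scale l r) :
  series (fun k => x k *: scale_unit k) @ \oo --> x.
Proof.
have hx := scale_sum x.
apply/cvgrPdist_lt => d d0.
have d1 : 0 < complex.Re d by rewrite -ltcR -ger0_Re // ltW.
have /cvgrPdist_lt /(_ _ (exprn_gt0 2 d1)) := hx.
apply: filterS => n /= /(le_lt_trans (ler_norm _)) hn.
set y := series _ n.
rewrite (ger0_Re (ltW d0)) ltcR.
have hs := scale_sum (x - y).
rewrite -(ltr_pXn2r (n := 2)) ?nnegrE ?sqrtr_ge0 ?(ltW d1) //.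
rewrite (wnorm_sq w0 hs); apply: le_lt_trans hn; apply: limr_le => //.
(* Since [y] cancels the first [n] coefficients, the partial sums of [x - y] past [n] are increments
   of those of [x]. *)
exists n => // m /= nm.
apply: (@le_trans _ _ (series (wterm w x) m - series (wterm w x) n)); last first.
  by rewrite lerD2r; exact: (wsummable_le w0 m hx).
have wk : wterm w (x - y) = fun k => if (k < n)%N then 0 else wterm w x k.
  apply/funext => k.
  have yk : coef (x - y) k = x k - (if (k < n)%N then x k else 0).
    by rewrite -coef_series_unit.
  rewrite /wterm yk; case: ifP => _; last by rewrite subr0.
  by rewrite subrr normc_sq /= expr0n addr0 mulr0.
rewrite wk sub_series_geq // /series /= (@big_cat_nat _ _ _ n) //= big1_seq.
  rewrite add0r big_nat_cond [leRHS]big_nat_cond; apply: ler_sum => k.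
  by move=> /andP[/andP[nk _] _]; rewrite ltnNge nk.
by move=> k /andP[_]; rewrite mem_index_iota => /andP[_ ->].
Qed.

Lemma scale_unit_total : closure (lin_span (range scale_unit)) = setT.
Proof.
apply/seteqP; split => // x _.
refine (closed_cvg (closure (lin_span (range scale_unit))) (@closed_closure _ _)
  _ _ (@scale_unit_expansion x)).
apply: nearW => n; apply: subset_closure.
exists n, (fun j : 'I_n => x j), (fun j : 'I_n => scale_unit j); split.
  by move=> j; exists (j : nat).
by rewrite /series /= big_mkord.
Qed.

Lemma linear_scale_expansion (W : normedModType R[i]) (f : scale l r -> W)
    (x : scale l r) :
  linear f -> continuous f ->
  series (fun k => x k *: f (scale_unit k)) @ \oo --> f x.
Proof.
move=> lf cf; have [g gf] := ex_linear lf.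
have -> : series (fun k => x k *: f (scale_unit k)) =
    f \o series (fun k => x k *: scale_unit k).
  apply/funext => n; rewrite /series /= -gf linear_sum.
  by apply: eq_bigr => k _; rewrite linearZ /= gf.
exact: continuous_cvg (cf x) (@scale_unit_expansion x).
Qed.

End scale_basis.

(** * Hilbert tensor powers and their pure tensors *)

Lemma prod_kronecker (I : finType) (T : eqType) (K : comPzRingType)
    (j k : {ffun I -> T}) :
  \prod_i (j i == k i)%:R = (j == k)%:R :> K.
Proof.
have [->|/eqP jk] := eqVneq; first by rewrite big1 // => i _; rewrite eqxx.
have [i jki] : exists i, j i != k i.
  apply: contrapT => h; apply: jk; apply/ffunP => i.
  by apply/eqP; apply: contrapT => /negP ?; apply: h; exists i.
by rewrite (bigD1 i) //= (negbTE jki) mul0r.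
Qed.

Section tensor_power.
Context {R : realType} {V T : hilbertType R} {n : nat} {t : ('I_n -> V) -> T}.
Hypothesis tP : hilbert_tensor_power t.

Lemma tens_norm x : `|t x| = \prod_j `|x j|.
Proof.
apply/eqP; rewrite -(eqrXn2 (n := 2)) ?prodr_ge0 //.
rewrite -innerxx (tens_inner tP) -prodrXl.
by apply/eqP; apply: eq_bigr => j _; rewrite innerxx.
Qed.

Lemma tens_upd_linear x i : linear (fun v => t (upd x i v)).
Proof. by move=> c v w; rewrite (tens_multilinear tP). Qed.

Lemma tens_upd_norm x i v :
  `|t (upd x i v)| = (\prod_(j | j != i) `|x j|) * `|v|.
Proof.
rewrite tens_norm (bigD1 i) //= mulrC {2}/upd eqxx; congr (_ * _).
by apply: eq_bigr => j /negbTE ji; rewrite /upd ji.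
Qed.

Lemma tens_upd_continuous x i : continuous (fun v => t (upd x i v)).
Proof.
apply: (linear_bound_continuous (C := \prod_(j | j != i) `|x j|)).
  exact: tens_upd_linear.
by move=> v; rewrite tens_upd_norm.
Qed.

Lemma tens_zero (W : normedModType R[i]) (f : T -> W) :
  linear f -> continuous f -> (forall x, f (t x) = 0) -> forall y, f y = 0.
Proof.
move=> lf cf f0 y.
apply: (linear_zero_closed (A := range t)) => //; first by move=> _ [x _ <-].
by rewrite (tens_dense tP).
Qed.

End tensor_power.

(** Induction on the number [m] of leading slots that are released from [D]; at [m = n] no
    constraint is left. *)
Lemma coordinatewise_extension (V T : Type) (n : nat) (t : ('I_n -> V) -> T)
    (A : set T) (D : set V) :
  (forall x i, (forall v, D v -> A (t (upd x i v))) ->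
    forall v, A (t (upd x i v))) ->
  (forall x, (forall i, D (x i)) -> A (t x)) -> forall x, A (t x).
Proof.
move=> AD A0 x.
suff /(_ n x) : forall m x, (forall i : 'I_n, (m <= i)%N -> D (x i)) -> A (t x).
  by apply=> i; rewrite leqNgt ltn_ord.
elim=> [|m IH] {}x Dx; first by apply: A0 => i; exact: Dx.
have [mn|nm] := ltnP m n; last first.
  by apply: IH => i mi; have := leq_trans nm mi; rewrite leqNgt ltn_ord.
pose i := Ordinal mn.
(* Seen as an update of itself at slot [m], [x] falls under [AD], which reduces that slot to values
   in [D]. *)
have -> : x = upd x i (x i).
  by apply/funext => j; rewrite /upd; case: eqP => [->|].
apply: AD => v Dv; apply: IH => j mj; rewrite /upd.
case: eqP => // /eqP ji; apply: Dx.
by rewrite ltn_neqAle mj andbT; apply: contraNneq ji => mj'; apply/eqP/val_inj.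
Qed.

(** * Tensors of basis units *)

Section scale_tensor.
Context {R : realType} {l : weight_seq R} {r : R} {T : hilbertType R} {n : nat}.
Context {t : ('I_n -> scale l r) -> T}.
Hypothesis tP : hilbert_tensor_power t.

Definition tens_unit (k : {ffun 'I_n -> nat}) : T :=
  t (fun j => scale_unit l r (k j)).

(** The squared norm of [tens_unit k]. *)
Definition tens_weight (k : {ffun 'I_n -> nat}) : R[i] :=
  \prod_j (scale_weight l r (k j))%:C.

Lemma tens_weight_gt0 k : 0 < tens_weight k.
Proof. by apply: prodr_gt0 => j _; rewrite ltcR scale_weight_gt0. Qed.

Lemma inner_tens_units j k :
  inner (tens_unit j) (tens_unit k) = (j == k)%:R * tens_weight k.
Proof.
rewrite (tens_inner tP); under eq_bigr do rewrite inner_scale_units.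
by rewrite big_split /= prod_kronecker.
Qed.

(** The units are total in each slot, so multilinearity and continuity carry the vanishing to all
    pure tensors slot by slot, and density carries it to the whole space. *)
Lemma tens_unit_zero (W : normedModType R[i]) (f : T -> W) :
  linear f -> continuous f -> (forall k, f (tens_unit k) = 0) ->
  forall y, f y = 0.
Proof.
move=> lf cf f0; apply: (tens_zero tP) => //.
apply: (@coordinatewise_extension _ _ _ t [set y | f y = 0]
  (range (scale_unit l r))) => [x i h v|x hx] /=.
- apply: (linear_zero_closed (A := range (scale_unit l r))
    (f := fun v => f (t (upd x i v)))).
  + by move=> c y z; rewrite (tens_upd_linear tP) lf.
  + by move=> y; apply: continuous_comp; [exact: tens_upd_continuous|exact: cf].
  + exact: h.
  + by rewrite scale_unit_total.
- have /choice[k kx] : forall i, exists k, scale_unit l r k = x i.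
    by move=> i; have [k _ <-] := hx i; exists k.
  have -> : t x = tens_unit (finfun k); last exact: f0.
  by congr t; apply/funext => i; rewrite -kx ffunE.
Qed.

End scale_tensor.

(** * Summable inverse weights and convergence in the dual *)

Lemma ex_inv_weight_bound (R : realType) (l : weight_seq R) :
  exists2 L : R, 0 <= L &
    forall m, series (fun k => (scale_weight l 1 k)^-1) m <= L.
Proof.
have qE : (fun k => (scale_weight l 1 k)^-1) = (fun k => l k ^- 2).
  apply/funext => k; rewrite /scale_weight mulr1 powR_mulrn //.
  exact: ltW (lt_trans ltr01 (wt_gt1 l k)).
have q0 k : 0 <= l k ^- 2.
  by rewrite invr_ge0 exprn_ge0 // ltW // (lt_trans ltr01) // wt_gt1.
rewrite qE; pose L := limn (series (fun k => l k ^- 2)).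
have qL m : series (fun k => l k ^- 2) m <= L.
  apply: nondecreasing_cvgn_le; last exact: wt_summable.
  by apply: nondecreasing_series => k _ _; exact: q0.
by exists L => //; apply: le_trans (qL 0%N); rewrite /series /= big_geq.
Qed.

(** Each step maps continuously into the inductive limit: a neighbourhood of 0 contains a set whose
    trace on the step is a neighbourhood of 0. *)
Lemma dual_cvg_of (R : realType) (l : weight_seq R) (r : R) (r0 : 0 <= r)
    (x : nat -> scale l (- r)) (s : scale l (- r)) :
  x @ \oo --> s -> dual_cvg (fun N => dual_of r0 (x N)) (dual_of r0 s).
Proof.
move=> xs U [A [_ /(_ r r0) A0 AU]].
have xs0 : (fun N => x N - s) @ \oo --> (0 : scale l (- r)).
  by rewrite -(subrr s); apply: cvgB => //; exact: cvg_cst.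
have : \forall N \near \oo, A (dual_of r0 (x N - s)) by exact: (xs0 _ A0).
apply: filterS => N /= AN; apply: AU.
have -> // : dual_of r0 (x N) - dual_of r0 s = dual_of r0 (x N - s).
exact: val_inj.
Qed.

Lemma dual_of_sum (R : realType) (l : weight_seq R) (r : R) (r0 : 0 <= r)
    (c : nat -> R[i]) (x : nat -> scale l (- r)) N :
  dual_of r0 (series (fun k => c k *: x k) N)
  = \sum_(k < N) c k *: dual_of r0 (x k).
Proof.
rewrite /series /= big_mkord; elim/big_rec2: _ => [|i y z _ <-]; exact: val_inj.
Qed.

(** Supplies the squared bound that [orthogonal_l1_le] asks for without extracting a square root. *)
Lemma le_sqr_add1 (R : realType) (x : R[i]) (L : R) :
  0 <= L -> x <= L%:C -> x <= (L + 1)%:C ^+ 2.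
Proof.
move=> L0 /le_trans -> //; rewrite -rmorphXn lecR.
by have := sqr_ge0 L; lra.
Qed.

(** * The adjoint in one variable and the density of its range *)

Section one_variable.
Context {R : realType} (l la : weight_seq R) (p M : R).
Hypothesis p0 : 0 <= p.
Context (ep : nat -> scale l (- p)).
Hypothesis epM : forall k, `|ep k| <= M%:C.
Local Notation w k := (scale_weight la 1 k)%:C.
Local Notation delta := (scale_unit la 1).

Let w_gt0 k : 0 < w k. Proof. by rewrite ltcR scale_weight_gt0. Qed.

(** By Cauchy-Schwarz the [k]-th weighted term is at most [(M |y|)^2 / w k], and the inverse weights
    are summable. *)
Lemma adj_subproof (y : scale l (- p)) :
  scale_pred la 1 (fun k => (w k)^-1 * inner (ep k) y).
Proof.
have [L L0 qL] := ex_inv_weight_bound la.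
pose C := complex.Re (M%:C * `|y|) ^+ 2.
apply/asboolP; apply: (wsummable_bounded (scale_weight_gt0 la 1) (B := C * L)).
move=> m; apply: le_trans (ler_wpM2l _ (qL m)); last exact: sqr_ge0.
rewrite /series /= mulr_sumr; apply: ler_sum => k _.
have W0 := scale_weight_gt0 la 1 k.
rewrite /wterm Normc.normcM exprMn -fmorphV normc_realC ?invr_ge0 ?(ltW W0) //.
rewrite [leLHS](_ : _ =
    Normc.normc (inner (ep k) y) ^+ 2 * (scale_weight la 1 k)^-1); last first.
  by rewrite [(_ ^-1) ^+ 2]expr2 -mulrA mulVKf ?gt_eqF // mulrC.
rewrite ler_pM2r ?invr_gt0 //.
have M0 : 0 <= M%:C by apply: le_trans (epM 0%N).
have yM : Normc.normc (inner (ep k) y) <= complex.Re (M%:C * `|y|).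
  rewrite -lecR -normcE' -ger0_Re ?mulr_ge0 //.
  apply: le_trans (norm_inner_le _ _) _; apply: ler_wpM2r (epM k).
  exact: normr_ge0.
by rewrite lerXn2r // nnegrE ?normc_ge0 // (le_trans _ yM) ?normc_ge0.
Qed.

(* The Hilbert space adjoint of the map [delta k |-> ep k]. *)
Definition adj (y : scale l (- p)) : scale la 1 := Scale (adj_subproof y).

Lemma inner_adj_unit y k : inner (adj y) (delta k) = inner y (ep k).
Proof.
have yk : coef (adj y) k = (w k)^-1 * inner (ep k) y by [].
by rewrite innerC inner_scale_unit yk mulVKf ?gt_eqF // -innerC.
Qed.

Hypothesis ep_inj : forall alpha : nat -> R[i],
  abs_summable alpha -> (exists k, alpha k != 0) ->
  forall s : dual l,
    dual_cvg (fun N => \sum_(k < N) alpha k *: dual_of p0 (ep k)) s -> s != 0.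

(** Density of the range of [adj], stated dually. The hypothesis on [phi] is exploited at [y = s],
    where [s] is the sum of the [alpha k *: ep k]: it gives [<s, s> = 0]. *)
Lemma adj_zero (phi : scale la 1 -> R[i]^o) (C : R[i]) :
  linear phi -> 0 <= C -> (forall v, `|phi v| <= C * `|v|) ->
  (forall y, phi (adj y) = 0) -> forall v, phi v = 0.
Proof.
move=> lphi C0 phiC phi0.
have cphi := linear_bound_continuous lphi phiC.
have [L L0 qL] := ex_inv_weight_bound la.
pose B := (L + 1)%:C.
have B0 : 0 <= B by rewrite lecR addr_ge0.
have l1 (s : seq nat) : uniq s ->
    \sum_(k <- s) `|(w k)^-1 * phi (delta k)| <= C * B.
  move=> us; apply: (orthogonal_l1_le (g := delta)) => //.
    exact: inner_scale_units.
  apply: le_sqr_add1 => //.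
  under eq_bigr do rewrite -fmorphV.
  rewrite -rmorph_sum lecR; apply: sum_uniq_le => // k.
  by rewrite invr_ge0 ltW // scale_weight_gt0.
pose alpha k := (w k)^-1 * conjc (phi (delta k)).
have alphaE k : `|alpha k| = `|(w k)^-1 * phi (delta k)|.
  by rewrite !normrM normcJ.
have alpha_abs : abs_summable alpha.
  apply: nondecreasing_is_cvgn.
    by apply: nondecreasing_series => k _ _; exact: normc_ge0.
  exists (complex.Re (C * B)) => _ [m _ <-].
  rewrite -lecR -ger0_Re ?mulr_ge0 // /series /= rmorph_sum /=.
  under eq_bigr do rewrite -normcE' alphaE.
  by apply: l1; exact: iota_uniq.
have [s hs] : exists s, has_sum (fun k => alpha k *: ep k) s.
  apply: (@abs_has_sum _ _ _ _ (C * B * M%:C)) => F.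
  apply: (@le_trans _ _ (\sum_(k <- F) `|alpha k| * M%:C)).
    by apply: ler_sum => k _; rewrite normrZ; apply: ler_wpM2l; [|exact: epM].
  rewrite -mulr_suml ler_wpM2r //; first exact: le_trans (epM 0%N).
  by under eq_bigr do rewrite alphaE; apply/l1/fset_uniq.
have ser := has_sum_series hs.
have s0 : s = 0.
  apply: inner_self_eq0.
  pose b k : R[i]^o := alpha k * inner s (ep k).
  have e1 : series b @ \oo --> (inner s s : R[i]^o).
    have -> : series b = inner s \o series (fun k => alpha k *: ep k).
      apply/funext => m; rewrite /series /= inner_sumr.
      by apply: eq_bigr => k _; rewrite innerZr.
    exact: cvg_comp ser (@inner_continuous _ _ s s).
  (* The expansion of [phi (adj s) = 0] along the units has the conjugates of the [b k] as terms. *)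
  have e2 : series b @ \oo --> (0 : R[i]^o).
    have := linear_scale_expansion (x := adj s) lphi cphi.
    rewrite phi0 => /cvgrPdist_lt h; apply/cvgrPdist_lt => d /h.
    apply: filterS => m; rewrite !sub0r !normrN; congr (_ < _).
    rewrite -[in LHS]normcJ /series /= rmorph_sum; congr (`| _ |).
    apply: eq_bigr => k _; rewrite /b (innerC (ep k) s).
    have conjM (x y z : R[i]) : conjc x = x ->
        conjc (x * y * z) = x * conjc z * conjc y.
      by move=> xr; rewrite !rmorphM /= xr mulrAC.
    apply: (conjM (w k)^-1 (inner (ep k) s) (phi (delta k))).
    by apply: conjc_ge0; rewrite invr_ge0 ltW.
  exact: (cvg_unique (@norm_hausdorff _ _) e1 e2).
(* A nonzero [alpha k] would make [s = 0] a relation excluded by [ep_inj]. *)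
have alpha0 k : alpha k = 0.
  apply: contrapT => /eqP ak.
  have cv := dual_cvg_of p0 ser.
  have fE : (fun N => dual_of p0 (series (fun k => alpha k *: ep k) N)) =
      (fun N => \sum_(k < N) alpha k *: dual_of p0 (ep k)).
    by apply/funext => N; rewrite dual_of_sum.
  rewrite fE in cv.
  have /eqP := ep_inj alpha_abs (ex_intro _ k ak) cv; apply.
  by rewrite s0; apply: val_inj.
move=> v; apply: (linear_zero_closed (A := range delta) lphi cphi).
  move=> _ [k _ <-]; have /eqP := alpha0 k.
  rewrite mulf_eq0 invr_eq0 gt_eqF //= conjc_eq0 => /eqP; exact.
by rewrite scale_unit_total.
Qed.

End one_variable.

(** * The imbedding of tensor powers *)

Lemma basis_sum_unit (R : realType) (V : hilbertType R) (u : nat -> V)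
    (l : weight_seq R) (r : R) k : basis_sum u (scale_unit l r k) = u k.
Proof.
apply/cvg_lim; first exact: norm_hausdorff.
apply: cvg_near_cst; exists k.+1 => // n /= kn; rewrite /series /=.
rewrite (bigD1_seq k) ?iota_uniq ?mem_index_iota //= eqxx scale1r.
by rewrite big1 ?addr0 // => j /negbTE ->; rewrite scale0r.
Qed.

Lemma orthonormal_tens_inner (R : realType) (V T : hilbertType R) (u : nat -> V)
    (n : nat) (t : ('I_n -> V) -> T) (j k : {ffun 'I_n -> nat}) :
  orthonormal_basis u -> hilbert_tensor_power t ->
  inner (t (fun i => u (j i))) (t (fun i => u (k i))) = (j == k)%:R.
Proof.
move=> [uu _] tP; rewrite (tens_inner tP) -prod_kronecker.
by apply: eq_bigr => i _; rewrite uu.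
Qed.

Theorem theorem3p2 (R : realType)
  (H : hilbertType R) (e : nat -> H) (He : orthonormal_basis e)
  (l : weight_seq R)
  (a : R) (Ha : 2^-1 < a) (ea : nat -> dual l)
  (C1 : forall k1 k2 : nat,
    (fun N : nat => ((N%:R `^ (2 * a - 1))^-1)%:C *
       \sum_(j < N) conjc (pairing e (ea k1) (e j)) * pairing e (ea k2) (e j)
       : R[i]^o) @ \oo --> ((k1 == k2)%:R : R[i]^o))
  (p M : R) (Hp : 0 < p) (HM : 0 < M)
  (* ep k is ea k seen as an element of E_(-p) *)
  (ep : nat -> scale l (- p))
  (C2 : forall k, dual_of (ltW Hp) (ep k) = ea k /\ `|ep k| <= M%:C)
  (C3 : forall alpha : nat -> R[i],
    abs_summable alpha -> (exists k, alpha k != 0) ->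
    forall s : dual l,
      dual_cvg (fun N => \sum_(k < N) alpha k *: ea k) s -> s != 0)
  (Hc : hilbertType R) (u : nat -> Hc) (Hu : orthonormal_basis u)
  (la : weight_seq R)
  (n : nat) (Hn : (1 <= n)%N)
  (TN : hilbertType R) (tN : ('I_n -> scale la 1) -> TN)
  (HTN : hilbert_tensor_power tN)
  (TH : hilbertType R) (tH : ('I_n -> Hc) -> TH)
  (HTH : hilbert_tensor_power tH)
  (TE : hilbertType R) (tE : ('I_n -> scale l (- p)) -> TE)
  (HTE : hilbert_tensor_power tE)
  (* the canonical map from the n-th tensor power of N_(a,1) to that of Hc *)
  (J : {linear TN -> TH}) (HJ : continuous J)
  (HJt : forall x : 'I_n -> scale la 1,
    J (tN x) = tH (fun j => basis_sum u (x j))) :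
  exists i : {linear TN -> TE},
    [/\ continuous i, injective i &
      forall f : TN,
        has_sum (fun k : {ffun 'I_n -> nat} =>
            inner (tH (fun j => u (k j))) (J f) *: tE (fun j => ep (k j)))
          (i f)].
Proof.
pose w := @tens_weight R la 1 n.
pose d := tens_unit (t := tN).
pose p0 : 0 <= p := ltW Hp.
have epM k : `|ep k| <= M%:C := (C2 k).2.
have w_gt0 k : 0 < w k by exact: tens_weight_gt0.
have dd : forall j k, inner (d j) (d k) = (j == k)%:R * w k.
  exact: inner_tens_units HTN.
pose c (k : {ffun 'I_n -> nat}) f := inner (tH (fun j => u (k j))) (J f).
have c_linear k : linear (c k : TN -> R[i]^o).
  by move=> x f g; rewrite /c linearP innerDr innerZr.
have cd k j : c k (d j) = (k == j)%:R.
  rewrite /c /d /tens_unit HJt.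
  have -> : (fun i => basis_sum u (scale_unit la 1 (j i))) = (fun i => u (j i)).
    by apply/funext => i; rewrite basis_sum_unit.
  exact: (orthonormal_tens_inner k j Hu HTH).
(* Both sides are linear and continuous in [f], so they are compared on the [d j] only. *)
have cE k f : c k f = (w k)^-1 * inner (d k) f.
  apply/eqP; rewrite -subr_eq0; apply/eqP.
  apply: (@tens_unit_zero _ _ _ _ _ _ HTN _
    (fun f => c k f - (w k)^-1 * inner (d k) f : R[i]^o)).
  - move=> x g h /=; rewrite c_linear innerDr innerZr.
    by rewrite mulrDr mulrCA opprD addrACA scalerBr.
  - move=> g; apply: cvgB.
      exact: cvg_comp (@HJ g) (@inner_continuous _ _ _ _).
    by apply: cvgMr; exact: inner_continuous.
  - move=> j; rewrite cd dd; case: eqP => [->|_].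
      by rewrite mul1r mulVf ?subrr // gt_eqF.
    by rewrite mul0r mulr0 subrr.
have [L L0 qL] := ex_inv_weight_bound la.
pose B := (L ^+ n + 1)%:C.
have B0 : 0 <= B by rewrite lecR addr_ge0 ?exprn_ge0.
pose trm f k := c k f *: tE (fun j => ep (k j)).
have M0 : 0 <= M%:C ^+ n by rewrite exprn_ge0 // lecR ltW.
(* Uniformity in [F] yields both the existence of the sum and the norm bound on [i0]. *)
have trm_bound f (F : {fset {ffun 'I_n -> nat}}) :
    \sum_(k <- F) `|trm f k| <= B * M%:C ^+ n * `|f|.
  apply: (@le_trans _ _
    (\sum_(k <- F) `|(w k)^-1 * inner f (d k)| * M%:C ^+ n)).
    apply: ler_sum => k _; rewrite /trm normrZ (tens_norm HTE).
    (* Conjugation leaves the modulus unchanged and puts [d k] in the linear argument of [inner], so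
       that [inner f] can serve as the tested functional. *)
    have -> : `|c k f| = `|(w k)^-1 * inner f (d k)|.
      by rewrite cE (innerC f) !normrM normcJ.
    apply: ler_wpM2l => //; have <- : \prod_(j < n) M%:C = M%:C ^+ n.
      by rewrite prodr_const card_ord.
    by apply: ler_prod => j _; rewrite normr_ge0 epM.
  rewrite -mulr_suml mulrAC ler_wpM2r // mulrC.
  apply: (orthogonal_l1_le (g := d) (inner_linear f)) => //.
  - exact: norm_inner_le.
  - exact: fset_uniq.
  apply: le_sqr_add1; first exact: exprn_ge0.
  have wE k : (w k)^-1 = (\prod_j (scale_weight la 1 (k j))^-1)%:C.
    by rewrite /w /tens_weight -rmorph_prod -fmorphV prodfV.
  under eq_bigr do rewrite wE.
  rewrite -rmorph_sum lecR.
  apply: (sum_prod_le (q := fun k => (scale_weight la 1 k)^-1)) => // [k|].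
    by rewrite invr_ge0 ltW // scale_weight_gt0.
  exact: fset_uniq.
have /choice[i0 i0P] : forall f, exists s, has_sum (trm f) s.
  by move=> f; apply: abs_has_sum (trm_bound f).
have i0_linear : linear i0.
  move=> x f g; apply: has_sum_unique (i0P _) _.
  have := has_sum_linear (c := x) (i0P f) (i0P g); congr (has_sum _ _).
  by apply/funext => k; rewrite /trm c_linear scalerDl scalerA.
have i0_norm f : `|i0 f| <= B * M%:C ^+ n * `|f|.
  exact: has_sum_norm_le (i0P f) (trm_bound f).
have i0_cont : continuous i0 := linear_bound_continuous i0_linear i0_norm.
have i0d k : i0 (d k) = tE (fun j => ep (k j)).
  apply: has_sum_unique (i0P _) _.
  have -> : tE (fun j => ep (k j)) = \sum_(j <- [fset k]%fset) trm (d k) j.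
    by rewrite big_seq_fset1 /trm cd eqxx scale1r.
  apply: has_sum_finite => j; rewrite inE => /negbTE jk.
  by rewrite /trm cd jk scale0r.
have [i iE] := ex_linear i0_linear.
exists i; split.
- by have -> : (i : TN -> TE) = i0 by apply/funext.
- move=> f g fg; apply/eqP; rewrite -subr_eq0; apply/eqP.
  set h := f - g; have ih : i0 h = 0 by rewrite -iE linearB /= fg subrr.
  (* The adjoint relation on tensors; on the units it is the product over the slots of
     [inner_adj_unit]. *)
  have adjE y v :
      inner (tE y) (i0 v) = inner (tN (fun j => adj la epM (y j))) v.
    apply/eqP; rewrite -subr_eq0; apply/eqP.
    apply: (@tens_unit_zero _ _ _ _ _ _ HTN _
      (fun v => inner (tE y) (i0 v)
        - inner (tN (fun j => adj la epM (y j))) v : R[i]^o)).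
    - move=> x v1 v2 /=; rewrite i0_linear !innerDr !innerZr.
      by rewrite opprD addrACA scalerBr.
    - move=> v1; apply: cvgB; last exact: inner_continuous.
      exact: cvg_comp (i0_cont v1) (@inner_continuous _ _ _ _).
    - move=> k; apply/eqP; rewrite i0d subr_eq0; apply/eqP.
      rewrite (tens_inner HTE) /tens_unit (tens_inner HTN).
      by apply: eq_bigr => j _; rewrite inner_adj_unit.
  (* (C3) transported along the identification of [ea k] with [ep k]. *)
  have ep_inj : forall alpha : nat -> R[i],
      abs_summable alpha -> (exists k, alpha k != 0) -> forall s : dual l,
      dual_cvg (fun N => \sum_(k < N) alpha k *: dual_of p0 (ep k)) s -> s != 0.
    move=> al al1 al0 s hs; apply: (C3 al al1 al0).
    have -> // : (fun N => \sum_(k < N) al k *: ea k) =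
      (fun N => \sum_(k < N) al k *: dual_of p0 (ep k)).
    by apply/funext => N; apply: eq_bigr => k _; rewrite -(C2 k).1.
  have hN : forall x, inner h (tN x) = 0.
    apply: (@coordinatewise_extension _ _ _ tN [set z | inner h z = 0]
      (range (adj la epM))) => [x j hx|x hx] /=.
    (* With the other slots fixed, pairing with [h] is a bounded functional of the slot [j]; the
       constant comes from Cauchy-Schwarz and [tens_upd_norm]. *)
    + apply: (@adj_zero _ l la p M p0 ep epM ep_inj
        (fun v => inner h (tN (upd x j v)) : R[i]^o)
        (`|h| * \prod_(k | k != j) `|x k|)).
      * by move=> b y z; rewrite (tens_upd_linear HTN) innerDr innerZr.
      * by rewrite mulr_ge0 // prodr_ge0.
      * move=> v; apply: le_trans (norm_inner_le _ _) _.
        by rewrite (tens_upd_norm HTN) mulrA.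
      * by move=> y; apply: hx; exists y.
    + have /choice[y yx] : forall j, exists y, adj la epM y = x j.
        by move=> j; have [y _ <-] := hx j; exists y.
      have -> : x = fun j => adj la epM (y j) by apply/funext => j.
      by rewrite innerC -adjE ih inner0r rmorph0.
  (* [inner h] vanishes on all pure tensors, hence everywhere, in particular at [h]. *)
  apply: inner_self_eq0.
  exact: (tens_zero HTN (inner_linear h) (@inner_continuous _ _ h) hN h).
- by move=> f; rewrite iE; exact: i0P.
Qed.
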